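(* Let $\gamma\in(0,2\beta_V)$, let $\alpha:=\frac{2\beta_V}{4\beta_V-\gamma}$, let $(\lambda_j)_{j\ge0}\subseteq(0,1/\alpha)$, let $z^0\in\mathcal H$, and suppose that $(z^j)_{j\ge0}$ is generated by the FDRS iteration $z^{k+1}=T_{\lambda_k}(z^k)$. Let $z^*$ be a fixed point of $T$ and $x^*:=P_Vz^*$. Then: 1. (``Best'' iterate convergence) Let $\varepsilon\in(0,1)$ and suppose that $(\lambda_j)_{j\ge0}\subseteq\left(0,\frac{(1-\varepsilon)(1+\varepsilon\alpha)}{\alpha}\right)$. If $\underline\lambda:=\inf_{j\ge0}\lambda_j>0$, then for all $k\ge 0$ $$\min_{0\le j\le k}\left(S_f(x_f^j,x^* )+S_h(x_h^j,x^* )\right)\le\frac{\left(1+\frac{(1+\varepsilon)\gamma}{\varepsilon^3(2\beta_V-\gamma)}\right)\|z^0-z^*\|^2}{4\gamma\underline\lambda(k+1)},$$ and $\min_{0\le j\le k}S_f(x_f^j,x^* )=o(1/(k+1))$ and $\min_{0\le j\le k}S_h(x_h^j,x^* )=o(1/(k+1))$. 2. (Ergodic convergence) If $\varepsilon\in(0,1)$ and $(\lambda_j)_{j\ge0}\subseteq\left(0,\frac{(1-\varepsilon)(1+\varepsilon\alpha)}{\alpha}\right)$, then for all $k\ge 0$ $$\frac{\mu_f}2\|\overline x_f^k-x^*\|^2+\frac{\mu_g}2\|\overline x_h^k-x^*\|^2\le\frac{\left(1+\frac{(1+\varepsilon)\gamma}{\varepsilon^3(2\beta_V-\gamma)}\right)\|z^0-z^*\|^2}{4\gamma\Lambda_k}.$$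 3. (Nonergodic convergence) If $\underline\tau:=\inf_{j\ge0}(1-\alpha\lambda_j)\lambda_j/\alpha>0$, then $S_f(x_f^k,x^* )+S_h(x_h^k,x^* )=o(1/\sqrt{k+1})$ and, for all $k\ge 0$, $$S_f(x_f^k,x^* )+S_h(x_h^k,x^* )\le\frac{(1+\gamma/\beta_V)\|z^0-z^*\|^2}{2\gamma\sqrt{\underline\tau(k+1)}}.$$
   Context: $\mathcal H$ is a real Hilbert space with identity map $I$; $V\subseteq\mathcal H$ is a closed vector subspace; $P_V,P_{V^\perp}$ are the orthogonal projections onto $V$ and $V^\perp$; $\chi_V$ is the indicator function of $V$ ($0$ on $V$, $+\infty$ elsewhere), so $\partial\chi_V(x)=V^\perp$ for $x\in V$ and $\emptyset$ otherwise. Standing assumptions: $f,g:\mathcal H\to(-\infty,\infty]$ are closed, proper and convex; $g$ is differentiable on $\mathcal H$ and $\nabla g$ is $(1/\beta)$-Lipschitz, $\beta>0$; $h:=g\circ P_V$, so $\nabla h=P_V\circ\nabla g\circ P_V$, and $\beta_V>0$ is such that $\nabla h$ is $(1/\beta_V)$-Lipschitz; there exists $x$ with $0\in\partial f(x)+\nabla g(x)+\partial\chi_V(x)$. The functions $f$ and $g$ are $\mu_f$- and $\mu_g$-strongly convex with $\mu_f,\mu_g\ge0$ (value $0$ means no strong convexity is assumed). Moreover $\beta_f\ge0$; if $\beta_f>0$ then $f$ is differentiable on $\mathcal H$ with $(1/\beta_f)$-Lipschitz gradient, while $\beta_f=0$ means no differentiability of $f$ is assumed. Define $S_f(x,y):=\max\{\frac{\mu_f}2\|x-y\|^2,\frac{\beta_f}2\|\nabla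 f(x)-\nabla f(y)\|^2\}$ if $\beta_f>0$ and $S_f(x,y):=\frac{\mu_f}2\|x-y\|^2$ otherwise; $S_h(x,y):=\max\{\frac{\mu_g}2\|P_Vx-P_Vy\|^2,\frac{\beta_V}2\|\nabla h(x)-\nabla h(y)\|^2\}$. For $\gamma>0$: $\mathrm{prox}_{\gamma f}(x):=\arg\min_{y}\left(f(y)+\frac1{2\gamma}\|y-x\|^2\right)$, $\mathrm{refl}_{\gamma f}:=2\,\mathrm{prox}_{\gamma f}-I$, $\mathrm{refl}_{\chi_V}:=2P_V-I$. The FDRS operator is $T:=\left(\frac12I+\frac12\mathrm{refl}_{\gamma f}\circ\mathrm{refl}_{\chi_V}\right)\circ(I-\gamma\nabla h)$, and $T_\lambda:=(1-\lambda)I+\lambda T$. The FDRS iteration from $z^0\in\mathcal H$ with relaxation parameters $(\lambda_j)_{j\ge0}$ is $z^{k+1}=T_{\lambda_k}(z^k)$, $k\ge0$. For each $k$: $x_h^k:=P_Vz^k$, $x_f^k:=\mathrm{prox}_{\gamma f}\big(\mathrm{refl}_{\chi_V}(z^k-\gamma\nabla h(z^k))\big)$, $\Lambda_k:=\sum_{i=0}^k\lambda_i$, $\overline x_f^k:=\frac1{\Lambda_k}\sum_{i=0}^k\lambda_ix_f^i$, $\overline x_h^k:=\frac1{\Lambda_k}\sum_{i=0}^k\lambda_ix_h^i$. *)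

(* Defs.v *)
From HB Require Import structures.
From mathcomp Require Import all_boot all_order all_algebra.
From mathcomp Require Import all_classical all_reals all_analysis.

Set Implicit Arguments.
Unset Strict Implicit.
Unset Printing Implicit Defensive.

Import Order.TTheory GRing.Theory Num.Theory.
Import numFieldNormedType.Exports.

Local Open Scope classical_set_scope.
Local Open Scope ring_scope.

HB.mixin Record CompleteNormedModule_isHilbert (R : realType) H
    & CompleteNormedModule R H := {
  inner : {dot H for idfun} ;
  sqr_norm_inner : forall x : H, `|x| ^+ 2 = inner x x
}.

#[short(type="hilbertType")]
HB.structure Definition Hilbert (R : realType) :=
  {H of CompleteNormedModule_isHilbert R H & CompleteNormedModule R H}.

Section ConvexAnalysis.
Context {R : realType} {H : hilbertType R}.
Implicit Types (f : H -> \bar R) (V : set H) (x y v : H).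

Definition proper_fun f :=
  (forall x, f x != -oo%E) /\ (exists x, f x != +oo%E).

(* Used only for functions that never take the value -oo, so that the
   right-hand side is never of the form +oo - oo.  At t = 0 and t = 1 the
   library convention 0 * +oo = 0 makes the inequality trivial. *)
Definition strongly_convex (mu : R) f := forall x y (t : R), 0 <= t <= 1 ->
  (f (t *: x + (1 - t) *: y)%R +
     (mu / 2 * t * (1 - t) * `|x - y| ^+ 2)%:E
   <= t%:E * f x + (1 - t)%:E * f y)%E.

Definition convex_ereal f := forall x y (t : R), 0 <= t <= 1 ->
  (f (t *: x + (1 - t) *: y)%R <= t%:E * f x + (1 - t)%:E * f y)%E.

Definition closed_proper_convex f :=
  [/\ lower_semicontinuous f, proper_fun f & convex_ereal f].

Definition subdiff f x : set H :=
  [set u | forall y, (f x + (inner u (y - x))%:E <= f y)%E].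

Definition differentiable_fun f := (forall x, f x \is a fin_num) /\
  (forall x, differentiable (fine \o f : H -> R^o) x).

(* The Riesz representer of the Frechet derivative; meaningful when f is
   differentiable at x. *)
Definition gradient f x : H :=
  xget 0 [set v | forall u, 'd (fine \o f : H -> R^o) x u = inner v u].

Definition closed_subspace V := submod_closed (mem V) /\ closed V.

Definition indicator V x : \bar R := if x \in V then 0%E else +oo%E.

Definition orthoproj V x : H :=
  xget 0 [set p | V p /\ forall v, V v -> inner (x - p) v = 0].

Definition prox (gamma : R) f x : H :=
  xget 0 [set p | forall y,
    (f p + ((2 * gamma)^-1 * `|p - x| ^+ 2)%:E
     <= f y + ((2 * gamma)^-1 * `|y - x| ^+ 2)%:E)%E].

Definition refl_prox (gamma : R) f x : H := 2 *: prox gamma f x - x.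

Definition refl_proj V x : H := 2 *: orthoproj V x - x.

Definition forward_step (gamma : R) (h : H -> \bar R) x : H :=
  x - gamma *: gradient h x.

Definition FDRS (gamma : R) f (g : H -> \bar R) V x : H :=
  let y := forward_step gamma (g \o orthoproj V) x in
  2^-1 *: y + 2^-1 *: refl_prox gamma f (refl_proj V y).

Definition relax (lambda : R) (T : H -> H) x : H :=
  (1 - lambda) *: x + lambda *: T x.

Definition S_f (mu_f beta_f : R) f x y : R :=
  if 0 < beta_f then
    Num.max (mu_f / 2 * `|x - y| ^+ 2)
            (beta_f / 2 * `|gradient f x - gradient f y| ^+ 2)
  else mu_f / 2 * `|x - y| ^+ 2.

Definition S_h (mu_g beta_V : R) (g : H -> \bar R) V x y : R :=
  let h := g \o orthoproj V in
  Num.max (mu_g / 2 * `|orthoproj V x - orthoproj V y| ^+ 2)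
          (beta_V / 2 * `|gradient h x - gradient h y| ^+ 2).

Definition x_h V (z : nat -> H) (k : nat) : H := orthoproj V (z k).

Definition x_f (gamma : R) f (g : H -> \bar R) V (z : nat -> H) (k : nat) : H :=
  prox gamma f (refl_proj V (forward_step gamma (g \o orthoproj V) (z k))).

Definition ergodic (lambda : nat -> R) (x : nat -> H) (k : nat) : H :=
  (\sum_(i < k.+1) lambda i)^-1 *: \sum_(i < k.+1) lambda i *: x i.

End ConvexAnalysis.

Definition min_upto {R : realType} (u : nat -> R) (k : nat) : R :=
  \big[Num.min/u 0%N]_(j < k.+1) u j.

(* Main.v *)
Require Import Defs.
From HB Require Import structures.
From mathcomp Require Import all_boot all_order all_algebra.
From mathcomp Require Import all_classical all_reals all_analysis.
From mathcomp Require Import ring lra zify.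

Set Implicit Arguments.
Unset Strict Implicit.
Unset Printing Implicit Defensive.

Import Order.TTheory GRing.Theory Num.Theory.
Import numFieldNormedType.Exports.

Local Open Scope classical_set_scope.
Local Open Scope ring_scope.

(** Write [P] for the projection onto [V], [G] for the gradient of [g o P], [X z]
    for the proximal point computed from [z] and [T] for the FDRS operator.
    Unfolding the definitions gives [T z = z + (X z - P z)] ([FDRSE]), and the
    optimality condition of the proximal step puts
    [U z = (2 P z - z - gamma G z - X z) / gamma] in the subdifferential of [f] at
    [X z] ([subdiff_prox_step]).

    For two points [z], [w], put [d = z - w], [e = (T z - z) - (T w - w)] and
    [D = G z - G w].  Since [P z - P w] is orthogonal to [d - (P z - P w)], the two
    monotonicity pairings combine ([gapE]) into
      [gamma <X z - X w, U z - U w> + gamma <P z - P w, D>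
         = - <e, d> - |e|^2 - gamma <e, D>].
    Call this number the gap.  Strong convexity and the Baillon--Haddad theorem
    bound the pairings below, so the gap is at least [2 gamma (S_f + S_h)]
    ([gap_S]) and at least [gamma beta_V |D|^2] ([gap_gradient]); completing the
    square in the latter shows that [T] is [alpha]-averaged
    ([residual_averaged]).

    Now take [w] to be the fixed point and [z] the iterate [z_k], so that
    [d_(k+1) = d_k + lambda_k e_k].  Expanding the square,
      [2 lambda gap = |d_k|^2 - |d_(k+1)|^2
         + (lambda^2 - 2 lambda) |e_k|^2 - 2 lambda gamma <e_k, D_k>].
    The restriction on [lambda_k] makes the quadratic form on the right at most a
    multiple of the decrease [|d_k|^2 - |d_(k+1)|^2] ([gap_decrease]), hence
    [sum lambda_k (S_f + S_h)] is finite with an explicit bound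
    ([weighted_sum_S]).  The best-iterate bounds and the ergodic bound (by
    convexity of the squared norm, [sqr_norm_ergodic]) follow, and the running
    minima, being nonincreasing and summable, are [o(1/(k+1))].

    For the last part, Cauchy--Schwarz bounds the gap by
    [(1 + gamma / beta_V) |e_k| |d_0|] ([S_le_residual]).  Averagedness makes
    [|e_k|^2] nonincreasing and summable, so [|e_k|] is [O] and [o] of
    [1 / sqrt (k+1)] ([residual_rate], [S_littleo]).

    Projections, Riesz representers and proximal points all exist by one
    minimization argument, [exists_minimizer]. *)

(** * Inner products and norms *)

Section InnerProduct.
Context {R : realType} {H : hilbertType R}.
Implicit Types (x y u v : H) (a : R).

Lemma innerC x y : inner x y = inner y x.
Proof. by rewrite hermC expr0 mul1r. Qed.

Lemma innerDl x y u : inner (x + y) u = inner x u + inner y u.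
Proof. exact: linearDl. Qed.

Lemma innerDr u x y : inner u (x + y) = inner u x + inner u y.
Proof. by rewrite !(innerC u) innerDl. Qed.

Lemma innerNl x u : inner (- x) u = - inner x u.
Proof. exact: linearNl. Qed.

Lemma innerNr u x : inner u (- x) = - inner u x.
Proof. by rewrite !(innerC u) innerNl. Qed.

Lemma innerZl a x u : inner (a *: x) u = a * inner x u.
Proof. exact: linearZl_LR. Qed.

Lemma innerZr u a x : inner u (a *: x) = a * inner u x.
Proof. by rewrite !(innerC u) innerZl. Qed.

Lemma inner0l u : inner 0 u = 0 :> R.
Proof. exact: linear0l. Qed.

Lemma inner0r u : inner u 0 = 0 :> R.
Proof. by rewrite innerC inner0l. Qed.

Definition innerE := (innerDl, innerDr, innerNl, innerNr, innerZl, innerZr,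
  inner0l, inner0r).

Lemma inner_ge0 x : 0 <= inner x x.
Proof. by rewrite -sqr_norm_inner sqr_ge0. Qed.

Lemma inner_eq0 x : inner x x = 0 -> x = 0.
Proof.
by rewrite -sqr_norm_inner => /eqP; rewrite expf_eq0 /= normr_eq0 => /eqP.
Qed.

Lemma inner_ext u v : (forall x, inner u x = inner v x) -> u = v.
Proof.
move=> uv; apply/eqP; rewrite -subr_eq0; apply/eqP/inner_eq0.
by rewrite innerDl innerNl uv subrr.
Qed.

Lemma cauchy_schwarz x y : inner x y <= `|x| * `|y|.
Proof.
have [->|x0] := eqVneq x 0; first by rewrite inner0l normr0 mul0r.
have [->|y0] := eqVneq y 0; first by rewrite inner0r normr0 mulr0.
have nx : 0 < `|x| by rewrite normr_gt0.
have ny : 0 < `|y| by rewrite normr_gt0.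
have := inner_ge0 (`|y| *: x - `|x| *: y).
rewrite !innerE -!sqr_norm_inner (innerC y x) => h.
have {}h : 0 <= (2 * (`|x| * `|y|)) * (`|x| * `|y| - inner x y).
  by apply: (le_trans h); rewrite le_eqVlt; apply/orP; left; apply/eqP; ring.
by rewrite pmulr_rge0 ?subr_ge0 // in h; rewrite !mulr_gt0.
Qed.

Lemma sqr_normD x y : `|x + y| ^+ 2 = `|x| ^+ 2 + 2 * inner x y + `|y| ^+ 2.
Proof. by rewrite !sqr_norm_inner !innerE (innerC y x); ring. Qed.

Lemma sqr_normZ a x : `|a *: x| ^+ 2 = a ^+ 2 * `|x| ^+ 2.
Proof. by rewrite !sqr_norm_inner !innerE; ring. Qed.

(** The strong convexity identity of the squared norm; at [t = 1/2] it is the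
    parallelogram law. *)
Lemma sqr_norm_conv (t : R) x y : `|t *: x + (1 - t) *: y| ^+ 2
  = t * `|x| ^+ 2 + (1 - t) * `|y| ^+ 2 - t * (1 - t) * `|x - y| ^+ 2.
Proof. by rewrite !sqr_norm_inner !innerE (innerC y x); ring. Qed.

End InnerProduct.

(** Linear identities between vectors are proved by pairing both sides with
    an arbitrary vector, which turns them into scalar identities. *)
Ltac vector_field :=
  apply: inner_ext => ?; rewrite ?innerE; field.

(** * Minimizers of strongly convex functions *)

Section Minimizers.
Context {R : realType} {H : hilbertType R}.
Implicit Types (F : H -> \bar R) (x y p : H) (c m r mu : R).

Lemma strongly_convex0 F : convex_ereal F -> strongly_convex 0 F.
Proof. by move=> cF x y t t01; rewrite !mul0r adde0; exact: cF. Qed.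

Lemma strongly_convex_le mu F x y (r s t : R) : strongly_convex mu F ->
  0 <= t <= 1 -> (F x <= r%:E)%E -> (F y <= s%:E)%E ->
  (F (t *: x + (1 - t) *: y)%R
   <= (t * r + (1 - t) * s - mu / 2 * t * (1 - t) * `|x - y| ^+ 2)%:E)%E.
Proof.
move=> cF t01 Fx Fy; rewrite EFinB leeBrDr //; apply: le_trans (cF _ _ _ t01) _.
have /andP[t0 t1] := t01.
rewrite [leRHS]EFinD; apply: leeD; rewrite EFinM lee_wpmul2l // lee_fin //.
by rewrite subr_ge0.
Qed.

Lemma proper_cases F x : proper_fun F ->
  F x = +oo%E \/ exists r, F x = r%:E.
Proof.
move=> [Fn _]; move: (Fn x); case: (F x) => [r|//|//] _; last by left.
by right; exists r.
Qed.

(** A minimizing sequence of the [2 c]-strongly convex function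
    [F + c |. - x| ^ 2] is Cauchy, and lower semicontinuity makes its limit a
    minimizer.  This yields metric projections ([F] an indicator
    function), Riesz representers ([F] a bounded linear form) and proximal
    points. *)
Lemma exists_minimizer F c m x : 0 < c -> closed_proper_convex F ->
  (forall y, (m%:E <= F y + (c * `|y - x| ^+ 2)%:E)%E) ->
  exists p, forall y,
    (F p + (c * `|p - x| ^+ 2)%:E <= F y + (c * `|y - x| ^+ 2)%:E)%E.
Proof.
move=> c0 [lF pF cF] Fm.
(* Values of the objective, described by real upper bounds so as to stay away
   from +oo. *)
pose A := [set r | exists y, (F y <= (r - c * `|y - x| ^+ 2)%:E)%E].
have A0 : A !=set0.
  have [_ [y Fy]] := pF; have [Fyoo|[r Fr]] := proper_cases y pF.
    by rewrite Fyoo in Fy.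
  by exists (r + c * `|y - x| ^+ 2); exists y; rewrite addrK Fr.
have Am : lbound A m.
  move=> r [y Fy]; have := Fm y.
  by rewrite -lee_fin => /le_trans; apply; rewrite -leeBrDr.
have iA : has_inf A by split=> //; exists m.
pose I := inf A.
have geI y r : (F y <= (r - c * `|y - x| ^+ 2)%:E)%E -> I <= r.
  by move=> Fy; apply: ge_inf; [exists m|exists y].
(* Near-minimizers are close to each other: their midpoint cannot do better than
   [I], while the parallelogram law gains [c |p - q|^2 / 4]. *)
have near_mid p q e : (F p <= (I + e - c * `|p - x| ^+ 2)%:E)%E ->
    (F q <= (I + e - c * `|q - x| ^+ 2)%:E)%E -> `|p - q| ^+ 2 <= 4 * e / c.
  move=> Fp Fq; have h01 : 0 <= (2^-1 : R) <= 1 by lra.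
  have := strongly_convex_le (strongly_convex0 cF) h01 Fp Fq.
  set w := _ *: p + _ *: q; set r := (X in (_ <= X%:E)%E) => Fw.
  have wx : `|w - x| ^+ 2 = 2^-1 * `|p - x| ^+ 2 + 2^-1 * `|q - x| ^+ 2
      - 4^-1 * `|p - q| ^+ 2.
    rewrite (_ : w - x = 2^-1 *: (p - x) + (1 - 2^-1) *: (q - x)).
      rewrite sqr_norm_conv (_ : p - x - (q - x) = p - q); first by field.
      by vector_field.
    by rewrite /w; vector_field.
  have Ir : I <= r + c * `|w - x| ^+ 2 by apply: (geI w); rewrite addrK.
  rewrite /r wx in Ir.
  rewrite ler_pdivlMr //; move: Ir.
  move: (`|p - x| ^+ 2) (`|q - x| ^+ 2) (`|p - q| ^+ 2) => P Q D Ir.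
  lra.
have /choice[y_ yP] : forall n : nat,
    exists y, (F y <= (I + n.+1%:R^-1 - c * `|y - x| ^+ 2)%:E)%E.
  move=> n; have n0 : 0 < n.+1%:R^-1 :> R by rewrite invr_gt0.
  have [r [y Fy] rI] := inf_adherent n0 iA.
  by exists y; apply: le_trans Fy _; rewrite lee_fin lerB // ltW.
have yI e : 0 < e -> \forall n \near \oo,
    (F (y_ n) <= (I + e - c * `|y_ n - x| ^+ 2)%:E)%E.
  move=> e0; near=> n; apply: le_trans (yP n) _; rewrite lee_fin lerB // lerD2l.
  by apply: ltW; near: n; exact: near_infty_natSinv_lt (PosNum e0).
have cy : cauchy (y_ @ \oo).
  apply/cauchy_exP => e e0.
  have e1 : 0 < c * e ^+ 2 / 8 by rewrite divr_gt0 // mulr_gt0 // exprn_gt0.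
  have [N _ yN] := yI _ e1.
  exists (y_ N); exists N => // n Nn /=.
  rewrite -ball_normE /=.
  have := near_mid _ _ _ (yN N (leqnn N)) (yN n Nn).
  rewrite (_ : 4 * _ / c = e ^+ 2 / 2); last by field; rewrite gt_eqF.
  move=> le2; rewrite -(ltr_pXn2r (_ : 0 < 2)%N) ?nnegrE ?normr_ge0 ?(ltW e0) //.
  by apply: le_lt_trans le2 _; rewrite gtr_pMr ?exprn_gt0 // invf_lt1 // ltr1n.
have [p yp] : exists p, y_ @ \oo --> p.
  by exists (lim (y_ @ \oo)); exact: cauchy_cvg cy.
have Fp : (F p <= (I - c * `|p - x| ^+ 2)%:E)%E.
  rewrite leNgt; apply/negP => Fp.
  have [a aI aF] : exists2 a : R, I - c * `|p - x| ^+ 2 < a & (a%:E < F p)%E.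
    have [Fpoo|[r Fr]] := proper_cases p pF.
      by exists (I - c * `|p - x| ^+ 2 + 1); rewrite ?Fpoo ?ltry ?ltrDl.
    rewrite Fr lte_fin in Fp *.
    by have [a1 a2] := midf_lt Fp; exists ((I - c * `|p - x| ^+ 2 + r) / 2).
  have [W Wp Wa] := lF p a aF.
  pose d := (a - (I - c * `|p - x| ^+ 2)) / 2.
  have d0 : 0 < d by rewrite divr_gt0 // subr_gt0.
  have yn : (fun n => c * `|y_ n - x| ^+ 2) @ \oo --> c * `|p - x| ^+ 2.
    apply: cvgMr; rewrite expr2; under eq_fun do rewrite expr2.
    have h : (fun n => `|y_ n - x|) @ \oo --> `|p - x|.
      by apply: cvg_norm; apply: cvgB => //; exact: cvg_cst.
    exact: cvgM.
  have /cvgrPdist_lt/(_ _ d0) nd := yn.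
  have /yp nW := Wp.
  have : \forall n \near \oo, False.
    near=> n.
    have Fa : (a%:E < F (y_ n))%E by apply: Wa; near: n; exact: nW.
    have Fn : (F (y_ n) <= (I + d - c * `|y_ n - x| ^+ 2)%:E)%E.
      by near: n; exact: yI.
    have /ltr_distlBl Hd : `|c * `|p - x| ^+ 2 - c * `|y_ n - x| ^+ 2| < d.
      by near: n.
    have := lt_le_trans Fa Fn; rewrite lte_fin.
    by move: Hd; rewrite /d; lra.
  by move=> [N _ /(_ N (leqnn N))].
exists p => y.
have [->|[r Fy]] := proper_cases y pF; first by rewrite addye // leey.
rewrite Fy -leeBrDr //; apply: le_trans Fp _.
by rewrite -EFinD lee_fin lerB //; apply: (geI y); rewrite addrK Fy.
Unshelve. all: by end_near. Qed.

End Minimizers.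

(** * Subgradients *)

Section Subgradients.
Context {R : realType} {H : hilbertType R}.
Implicit Types (F : H -> \bar R) (V : set H) (x y u v p q : H) (c m r mu : R).

Lemma ler_vanishing (a b k : R) :
  (forall t, 0 < t <= 1 -> a <= b + t * k) -> a <= b.
Proof.
move=> h; apply/ler_addgt0Pr => e e0.
have k1 : 0 < `|k| + 1 by rewrite ltr_pwDr.
pose t := Num.min 1 (e / (`|k| + 1)).
have t0 : 0 < t by rewrite lt_min ltr01 divr_gt0.
apply: le_trans (h t _) _; first by rewrite t0 ge_min lexx.
rewrite lerD2l; apply: (@le_trans _ _ (t * (`|k| + 1))).
  by rewrite ler_wpM2l ?(ltW t0) // ler_wpDr // ler_norm.
by rewrite -ler_pdivlMr // ge_min lexx orbT.
Qed.

Lemma subdiff_fin F p u : proper_fun F -> subdiff F p u ->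
  exists r, F p = r%:E.
Proof.
move=> pF Fu; have [Fp|//] := proper_cases p pF.
have [_ [q /eqP]] := pF; case; have := Fu q; rewrite Fp addye //.
by rewrite leye_eq => /eqP.
Qed.

(** Comparing the minimizer with the points of the segment towards [y] gives
    the subgradient inequality up to an error of second order in the length. *)
Lemma minimizer_subgrad F c x p : proper_fun F -> convex_ereal F ->
  (forall y,
    (F p + (c * `|p - x| ^+ 2)%:E <= F y + (c * `|y - x| ^+ 2)%:E)%E) ->
  subdiff F p ((2 * c) *: (x - p)).
Proof.
move=> pF cF minp.
have [r Fp] : exists r, F p = r%:E.
  have [Fp|//] := proper_cases p pF.
  have [_ [q /eqP]] := pF; case; have := minp q.
  by rewrite Fp addye //; have [//|[s ->]] := proper_cases q pF.
move=> y; have [->|[s Fy]] := proper_cases y pF; first by rewrite leey.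
rewrite Fp Fy -EFinD lee_fin.
suff : r <= s - 2 * c * inner (x - p) (y - p) by rewrite innerZl lerBrDr.
apply: (@ler_vanishing _ _ (c * `|y - p| ^+ 2)) => t /andP[t0 t1].
have t01 : 0 <= t <= 1 by rewrite ltW.
have Fys : (F y <= s%:E)%E by rewrite Fy.
have Fpr : (F p <= r%:E)%E by rewrite Fp.
have := strongly_convex_le (strongly_convex0 cF) t01 Fys Fpr.
set w := _ *: y + _ *: p => Fw.
have := le_trans (minp w) (leeD2r _ Fw).
rewrite Fp -!EFinD lee_fin.
have -> : w - x = (p - x) + t *: (y - p) by rewrite /w; vector_field.
rewrite (sqr_normD (p - x) (t *: _)) sqr_normZ innerZr.
rewrite (_ : inner (p - x) _ = - inner (x - p) (y - p)); last first.
  by rewrite -innerNl opprB.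
move=> h.
have h2 : t * r <= t * (s - 2 * c * inner (x - p) (y - p)
    + t * (c * `|y - p| ^+ 2)).
  by move: h; rewrite !mul0r subr0; lra.
by rewrite ler_pM2l in h2.
Qed.

(** Along the segment from [p] to [y], strong convexity beats the plain
    subgradient inequality by a term of second order; dividing by the length and
    letting it vanish keeps the quadratic term. *)
Lemma subdiff_strong mu F p y u r s : strongly_convex mu F ->
  subdiff F p u -> F p = r%:E -> F y = s%:E ->
  r + inner u (y - p) + mu / 2 * `|y - p| ^+ 2 <= s.
Proof.
move=> cF Fu Fp Fy.
apply: (@ler_vanishing _ _ (mu / 2 * `|y - p| ^+ 2)) => t /andP[t0 t1].
have t01 : 0 <= t <= 1 by rewrite ltW.
have Fys : (F y <= s%:E)%E by rewrite Fy.
have Fpr : (F p <= r%:E)%E by rewrite Fp.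
have := strongly_convex_le cF t01 Fys Fpr.
set w := _ *: y + _ *: p => /(le_trans (Fu w)).
rewrite Fp -!EFinD lee_fin.
have -> : w - p = t *: (y - p) by rewrite /w; vector_field.
rewrite innerZr => h.
have h2 : t * (r + inner u (y - p) + mu / 2 * `|y - p| ^+ 2)
    <= t * (s + t * (mu / 2 * `|y - p| ^+ 2)) by move: h; lra.
by rewrite ler_pM2l in h2.
Qed.

Lemma subdiff_monotone mu F p q u v : proper_fun F -> strongly_convex mu F ->
  subdiff F p u -> subdiff F q v ->
  mu * `|p - q| ^+ 2 <= inner (p - q) (u - v).
Proof.
move=> pF cF Fu Fv.
have [r Fp] := subdiff_fin pF Fu; have [s Fq] := subdiff_fin pF Fv.
have := subdiff_strong cF Fu Fp Fq; have := subdiff_strong cF Fv Fq Fp.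
rewrite distrC -[q - p]opprB innerNr !(innerC _ (p - q)) innerDr innerNr.
by lra.
Qed.

End Subgradients.

(** * Orthogonal projection onto a closed subspace *)

Section Projection.
Context {R : realType} {H : hilbertType R} {V : set H}.
Hypothesis hV : closed_subspace V.
Implicit Types (x y u v : H).

Let P := orthoproj V.

Let V0 : V 0.
Proof. by have [[h _] _] := hV; move: h; rewrite inE. Qed.

Let VS a u v : V u -> V v -> V (a *: u + v).
Proof.
have [[_ h] _] := hV.
by move=> Vu Vv; have := h a u v; rewrite !inE; exact.
Qed.

Lemma closed_proper_convex_indicator : closed_proper_convex (indicator V).
Proof.
have [_ clV] := hV; split.
- move=> x a; rewrite /indicator; case: ifPn => xV ax.
    exists setT => [|y _]; first exact: filterT.
    by case: ifPn => // _; rewrite ltry.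
  exists (~` V) => [|y /= yV]; last by rewrite memNset // ltry.
  by apply: open_nbhs_nbhs; split; [exact: closed_openC|rewrite notin_setE in xV].
- split=> [x|]; first by rewrite /indicator; case: ifP.
  by exists 0; rewrite /indicator mem_set.
- move=> x y t /andP[t0 t1].
  have [->|t0'] := eqVneq t 0.
    by rewrite mul0e add0e scale0r add0r subr0 scale1r mul1e.
  have [->|t1'] := eqVneq t 1.
    by rewrite subrr mul0e adde0 scale0r addr0 scale1r mul1e.
  have tp : (0 < t%:E)%E by rewrite lte_fin lt0r t0'.
  have tq : (0 < (1 - t)%:E)%E by rewrite lte_fin subr_gt0 lt_neqAle t1'.
  rewrite {2 3}/indicator; case: ifPn => xV; case: ifPn => yV.
  + rewrite !mule0 adde0 /indicator ifT // inE; rewrite !inE in xV yV.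
    apply: VS => //; rewrite -[_ *: _]addr0; exact: VS.
  + by rewrite mule0 (gt0_muley tq) add0e leey.
  + by rewrite mule0 (gt0_muley tp) adde0 leey.
  + by rewrite (gt0_muley tp) (gt0_muley tq) leey.
Qed.

(** For the indicator of [V] the subgradient inequality at the minimizer [p],
    read at [p + v] and [p - v], is orthogonality. *)
Lemma orthoprojP x : V (P x) /\ forall v, V v -> inner (x - P x) v = 0.
Proof.
apply: (@xgetPex _ 0 [set p | V p /\ forall v, V v -> inner (x - p) v = 0]).
have ind := closed_proper_convex_indicator; have [_ pr cv] := ind.
have pos y : (0%:E <= indicator V y + (1 * `|y - x| ^+ 2)%:E)%E.
  apply: adde_ge0; first by rewrite /indicator; case: ifP.
  by rewrite lee_fin mul1r.
have [p /(minimizer_subgrad pr cv) sp] := exists_minimizer (@ltr01 R) ind pos.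
have Vp : V p.
  have [r] := subdiff_fin pr sp; rewrite /indicator.
  by case: ifPn => //; rewrite inE.
exists p; split=> //.
have le0 v : V v -> inner (x - p) v <= 0.
  move=> Vv; have := sp (p + v); rewrite /indicator !mem_set //.
    by rewrite add0e lee_fin innerZl [p + v]addrC addrK pmulr_rle0 // mulr1.
  by rewrite addrC -[v]scale1r; exact: VS.
move=> v Vv; apply/eqP; rewrite eq_le le0 //=.
have := le0 (- v); rewrite innerNr oppr_le0; apply.
by rewrite -[- v]addr0 -scaleN1r; exact: VS.
Qed.

Lemma orthoproj_in x : V (P x). Proof. by have [] := orthoprojP x. Qed.

Lemma orthoproj_unique x p :
  V p -> (forall v, V v -> inner (x - p) v = 0) -> P x = p.
Proof.
move=> Vp xp; have [VP xP] := orthoprojP x.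
have Vd : V (P x - p).
  by rewrite addrC -[- p]scaleN1r; exact: VS.
apply/eqP; rewrite -subr_eq0; apply/eqP/inner_eq0.
have -> : inner (P x - p) (P x - p)
    = inner (x - p) (P x - p) - inner (x - P x) (P x - p).
  rewrite -innerNl -innerDl (_ : x - p - (x - P x) = P x - p) //.
  by vector_field.
by rewrite xp // xP // subrr.
Qed.

Lemma orthoprojD x y : P (x + y) = P x + P y.
Proof.
apply: orthoproj_unique => [|v Vv].
  by rewrite -[P x]scale1r; apply: VS; exact: orthoproj_in.
rewrite opprD addrACA innerDl.
by rewrite !(orthoprojP _).2 // addr0.
Qed.

Lemma orthoprojZ a x : P (a *: x) = a *: P x.
Proof.
apply: orthoproj_unique => [|v Vv].
  by rewrite -[_ *: _]addr0; apply: VS => //; exact: orthoproj_in.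
by rewrite -scalerBr innerZl (orthoprojP _).2 // mulr0.
Qed.

Lemma orthoprojB x y : P (x - y) = P x - P y.
Proof. by rewrite orthoprojD -scaleN1r orthoprojZ scaleN1r. Qed.

Lemma orthoproj_id x : V x -> P x = x.
Proof.
by move=> Vx; apply: orthoproj_unique => // v _; rewrite subrr inner0l.
Qed.

Lemma orthoprojK x : P (P x) = P x.
Proof. exact/orthoproj_id/orthoproj_in. Qed.

Lemma inner_orthoproj x v : V v -> inner (P x) v = inner x v.
Proof.
move=> /(orthoprojP x).2; rewrite innerDl innerNl => /eqP.
by rewrite subr_eq0 => /eqP.
Qed.

Lemma orthoproj_adj x y : inner (P x) y = inner x (P y).
Proof.
by rewrite -[RHS](inner_orthoproj _ (orthoproj_in _)) [RHS]innerC
  (inner_orthoproj _ (orthoproj_in _)) innerC.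
Qed.

Lemma norm_orthoproj x : `|P x| <= `|x|.
Proof.
have [->|Px0] := eqVneq (P x) 0; first by rewrite normr0.
have nP : 0 < `|P x| by rewrite normr_gt0.
rewrite -(ler_pM2r nP) -expr2 sqr_norm_inner.
by rewrite (inner_orthoproj _ (orthoproj_in _)) cauchy_schwarz.
Qed.

Lemma orthoproj_linear : linear P.
Proof. by move=> a x y; rewrite orthoprojD orthoprojZ. Qed.

End Projection.

(** * Gradients of convex functions *)

Section Gradients.
Context {R : realType} {H : hilbertType R}.
Implicit Types (F : H -> \bar R) (x y u v p q d : H) (r mu b : R).

(** The representer of [phi] is the minimizer of [|. | ^ 2 / 2 - phi]. *)
Lemma riesz (phi : {linear H -> R^o}) : continuous phi ->
  exists v, forall u, phi u = inner v u.
Proof.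
move=> cphi; pose F u : \bar R := (- (phi u : R))%:E.
have prF : proper_fun F by split=> //; exists 0.
have cvF : convex_ereal F.
  move=> x y t _; rewrite /F -!EFinM -EFinD lee_fin linearD !linearZ /=.
  by rewrite !mulrN opprD.
have hF : closed_proper_convex F.
  split=> // x a; rewrite /F lte_fin => ax.
  exists [set y | phi y < - a]; last by move=> y /=; rewrite lte_fin ltrNr.
  apply: (cphi x [set z : R^o | z < - a]); apply: open_nbhs_nbhs.
  by split; [exact: open_lt|rewrite /= ltrNr].
have /linear_bounded_continuous/linear_boundedP/pinfty_ex_gt0[M M0 phiM] := cphi.
have lbF u : ((- (M ^+ 2 / 2))%:E <= F u + (2^-1 * `|u - 0| ^+ 2)%:E)%E.
  rewrite /F -EFinD lee_fin subr0.
  have : phi u <= M * `|u| by apply: le_trans (phiM u); exact: ler_norm.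
  by have := sqr_ge0 (M - `|u|); move: (phi u : R) => w; nra.
have h2 : 0 < 2^-1 :> R by rewrite invr_gt0.
have [p /(minimizer_subgrad prF cvF) sp] := exists_minimizer h2 hF lbF.
have le u : - phi p - inner p u <= - phi (p + u) :> R.
  have := sp (p + u); rewrite lee_fin innerZl [p + u]addrC addrK add0r innerNl.
  by rewrite mulfV // mul1r.
exists p => u; apply/eqP; rewrite eq_le; apply/andP; split.
  by have := le u; rewrite linearD /=; move: (phi p : R) (phi u : R) => *; lra.
have := le (- u); rewrite linearB /= innerNr.
by move: (phi p : R) (phi u : R) => *; lra.
Qed.

Lemma gradientE F x u : differentiable_fun F ->
  'd (fine \o F : H -> R^o) x u = inner (gradient F x) u.
Proof.
move=> [_ dF]; have [v Fv] := riesz (diff_continuous (dF x)).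
have := @xgetI _ 0 [set v | forall u,
  'd (fine \o F : H -> R^o) x u = inner v u] v Fv.
exact.
Qed.

Lemma gradient_unique F x v :
  (forall u, 'd (fine \o F : H -> R^o) x u = inner v u) -> gradient F x = v.
Proof.
move=> Fv; have := @xgetI _ 0 [set v | forall u,
  'd (fine \o F : H -> R^o) x u = inner v u] v Fv.
by rewrite -/(gradient F x) => /= gF; apply: inner_ext => u; rewrite -gF Fv.
Qed.

Lemma difference_quotient F x d : differentiable_fun F ->
  h^-1 *: ((fine (F (h *: d + x)) : R^o) - fine (F x)) @[h --> 0^']
    --> (inner (gradient F x) d : R^o).
Proof.
move=> dF; have [_ /(_ x) dFx] := dF.
rewrite -gradientE // -(deriveE d dFx).
exact: (@diff_derivable _ _ _ (fine \o F : H -> R^o) x d dFx).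
Qed.

Lemma difference_quotient_lt F x d (e : R) : differentiable_fun F -> 0 < e ->
  exists2 t : R, 0 < t <= 1 &
  `|inner (gradient F x) d - t^-1 * (fine (F (t *: d + x)) - fine (F x))| < e.
Proof.
move=> dF e0; have /cvgrPdist_lt/(_ e e0) := @difference_quotient F x d dF.
move=> [r /= r0 rh]; exists (Num.min 1 (r / 2)).
  by rewrite lt_min ltr01 divr_gt0 //= ge_min lexx.
apply: rh; last first.
  by rewrite gt_eqF // lt_min ltr01 divr_gt0.
rewrite /= sub0r normrN gtr0_norm ?lt_min ?ltr01 ?divr_gt0 //.
by rewrite gt_min; apply/orP; right; rewrite gtr_pMr // invf_lt1 // ltr1n.
Qed.

Lemma gradient_subdiff F x : differentiable_fun F -> convex_ereal F ->
  subdiff F x (gradient F x).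
Proof.
move=> dF cF y; have [fF _] := dF.
rewrite -(fineK (fF x)) -(fineK (fF y)) -EFinD lee_fin.
suff : inner (gradient F x) (y - x) <= fine (F y) - fine (F x) by lra.
apply/ler_addgt0Pr => e e0.
have [t /andP[t0 t1]] := difference_quotient_lt x (y - x) dF e0.
have t01 : 0 <= t <= 1 by rewrite ltW.
have := cF y x t t01.
rewrite (_ : t *: y + _ = t *: (y - x) + x); last by vector_field.
rewrite -(fineK (fF x)) -(fineK (fF y)) -(fineK (fF (_ + x))) /=.
rewrite -!EFinM -EFinD lee_fin => Ft.
have : t^-1 * (fine (F (t *: (y - x) + x)) - fine (F x))
    <= fine (F y) - fine (F x).
  by rewrite ler_pdivrMl //; lra.
by move=> h /ltr_distlDr; lra.
Qed.

(** A subgradient is below every directional derivative, and a linear form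
    below another one equals it. *)
Lemma subdiff_gradient F x u : differentiable_fun F -> subdiff F x u ->
  u = gradient F x.
Proof.
move=> dF Fu; have [fF _] := dF.
have le d : inner u d <= inner (gradient F x) d.
  apply/ler_addgt0Pr => e e0.
  have [t /andP[t0 t1]] := difference_quotient_lt x d dF e0.
  have := Fu (t *: d + x).
  rewrite addrK innerZr -(fineK (fF x)) -(fineK (fF (_ + x))) -EFinD lee_fin.
  move=> Ft; have : inner u d <=
      t^-1 * (fine (F (t *: d + x)) - fine (F x)).
    by rewrite ler_pdivlMl //; lra.
  by move=> h /ltr_distlCDr; lra.
apply: inner_ext => d; apply/eqP; rewrite eq_le le /=.
by have := le (- d); rewrite !innerNr lerN2.
Qed.

Lemma lipschitz_norm (T : H -> H) k x y : k.-lipschitz T ->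
  `|T x - T y| <= k * `|x - y|.
Proof. by move=> kT; exact: (kT (x, y)). Qed.

(** Descent lemma: along the segment, the derivative of the difference of the
    two sides has constant sign. *)
Lemma descent F (L : R) x d : differentiable_fun F -> L.-lipschitz (gradient F) ->
  fine (F (x + d)) <= fine (F x) + inner (gradient F x) d + L / 2 * `|d| ^+ 2.
Proof.
move=> dF lF.
pose phi (t : R) : R^o := fine (F (t *: d + x)).
pose dphi (t : R) := inner (gradient F (t *: d + x)) d.
have dphiP (t : R) : is_derive t 1 phi (dphi t).
  have := @difference_quotient F (t *: d + x) d dF.
  rewrite (_ : (fun h : R => _) =
      fun h => h^-1 *: ((phi \o shift t) (h *: 1) - phi t)); last first.
    apply/funext => h; rewrite /phi /= scalerDl addrA.
    by rewrite (_ : h *: 1 = h) // /GRing.scale /= mulr1.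
  move=> ph; split; last exact: cvg_lim ph.
  by apply/cvg_ex; exists (dphi t).
pose psi := phi - (inner (gradient F x) d \*: (id : R -> R^o))
  - ((L / 2 * `|d| ^+ 2) \*: ((id : R -> R^o) ^+ 2)).
have dpsi (t : R) : is_derive t (1 : R) psi
    (dphi t - inner (gradient F x) d - L * t * `|d| ^+ 2).
  apply: is_derive_eq.
  rewrite /GRing.scale /= !mulr1 expr1; congr (_ - _).
  by move: (`|d| ^+ 2) => D; field.
have [|t] := @MVT R psi _ 0 1 ltr01 (fun t _ => dpsi t).
  apply: derivable_within_continuous => t _; exact: ex_derive.
rewrite in_itv /= => /andP[t0 t1].
have dle : dphi t - inner (gradient F x) d <= L * t * `|d| ^+ 2.
  rewrite -innerNl -innerDl; apply: le_trans (cauchy_schwarz _ _) _.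
  rewrite expr2 mulrA ler_wpM2r //.
  apply: le_trans (lipschitz_norm _ _ lF) _.
  by rewrite addrK normrZ gtr0_norm // mulrA.
rewrite subr0 mulr1.
have -> : psi 1 = phi 1 - inner (gradient F x) d - L / 2 * `|d| ^+ 2.
  rewrite /psi !fctE /GRing.scale /=.
  by rewrite expr1n; congr (_ - _ - _); exact: mulr1.
have -> : psi 0 = phi 0.
  rewrite /psi !fctE /GRing.scale /=.
  by rewrite expr0n !scaler0 !subr0.
rewrite /phi scale1r scale0r add0r [d + x]addrC; move: dle.
move: (dphi t) (inner _ d) (fine _) (fine _) (L / 2 * _) (L * t * _).
by move=> a1 a2 a3 a4 a5 a6; lra.
Qed.

(** Baillon--Haddad: the convex function [F - <gradient F x, .>] is minimal at
    [x]; comparing that minimum with the value after a gradient step from [y]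
    and exchanging [x] and [y] gives cocoercivity. *)
Lemma cocoercive F b x y : differentiable_fun F -> convex_ereal F -> 0 < b ->
  (b^-1).-lipschitz (gradient F) ->
  b * `|gradient F x - gradient F y| ^+ 2
  <= inner (x - y) (gradient F x - gradient F y).
Proof.
move=> dF cF b0 lF; have [fF _] := dF.
(* The point [v + b (gradient F u - gradient F v)] is the gradient step from [v] for
   [F - <gradient F u, .>], whose minimum is at [u]. *)
have half u v : fine (F u) + inner (gradient F u) (v - u)
    + b / 2 * `|gradient F u - gradient F v| ^+ 2 <= fine (F v).
  have := gradient_subdiff u dF cF (v + b *: (gradient F u - gradient F v)).
  rewrite -(fineK (fF u)) -(fineK (fF (_ + _))) -EFinD lee_fin /=.
  move/le_trans => /(_ _ (descent v _ dF lF)).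
  move: (gradient F u) (gradient F v) (fine _) (fine _) => gu gv Fu Fv.
  rewrite (_ : v + _ - u = (v - u) + b *: (gu - gv)); last by vector_field.
  rewrite innerDr sqr_normZ (_ : inner gu (b *: _) =
    b * `|gu - gv| ^+ 2 + inner gv (b *: (gu - gv))); last first.
    by rewrite sqr_norm_inner !innerE; ring.
  rewrite (_ : b^-1 / 2 * (b ^+ 2 * _) = b / 2 * `|gu - gv| ^+ 2).
    by move: (inner _ _) (inner _ _) (`|_| ^+ 2) => i j k; lra.
  by field; rewrite gt_eqF.
have := half x y; have := half y x.
move: (gradient F x) (gradient F y) => gx gy.
rewrite (distrC gy) -[y - x]opprB innerNr (innerC _ (gx - gy)).
rewrite (innerDl gx) innerNl.
move: (inner _ _) (inner _ _) (fine _) (fine _) (`|_| ^+ 2) => i j k l m.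
by lra.
Qed.

Lemma gradient_monotone mu F x y : proper_fun F -> strongly_convex mu F ->
  differentiable_fun F -> convex_ereal F ->
  mu * `|x - y| ^+ 2 <= inner (x - y) (gradient F x - gradient F y).
Proof.
by move=> pF sF dF cF; apply: subdiff_monotone sF _ _ => //;
  exact: gradient_subdiff.
Qed.

End Gradients.

(** * Gradient of a function composed with the projection *)

Section GradientProjection.
Context {R : realType} {H : hilbertType R} {V : set H} {g : H -> \bar R}.
Hypothesis hV : closed_subspace V.
Hypothesis dg : differentiable_fun g.
Let P := orthoproj V.
Let h := g \o P.

Let Plin : {linear H -> H} :=
  HB.pack P (GRing.isLinear.Build R H H _ P (orthoproj_linear hV)).

Let Pcont : continuous Plin.
Proof.
apply/linear_bounded_continuous/linear_boundedP.
near=> r => x; apply: le_trans (norm_orthoproj hV x) _.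
by rewrite ler_peMl //; near: r; exact: nbhs_pinfty_ge.
Unshelve. all: by end_near. Qed.

Lemma differentiable_comp_orthoproj : differentiable_fun h.
Proof.
have [fg dfg] := dg; split=> x; first exact: fg.
apply: (@differentiable_comp _ _ _ _ Plin (fine \o g)).
  by apply: linear_differentiable; exact: Pcont.
exact: dfg.
Qed.

Lemma gradient_comp_orthoproj x : gradient h x = P (gradient g (P x)).
Proof.
apply: gradient_unique => u; have [_ dfg] := dg.
have -> : 'd (fine \o h : H -> R^o) x u
    = 'd (fine \o g : H -> R^o) (P x) (P u).
  have dP : differentiable Plin x.
    by apply: linear_differentiable; exact: Pcont.
  have := diff_comp dP (dfg (Plin x)); rewrite (diff_lin _ Pcont).
  by move=> /(congr1 (fun k => k u)).
by rewrite gradientE // (orthoproj_adj hV).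
Qed.

Lemma convex_comp_orthoproj : convex_ereal g -> convex_ereal h.
Proof.
move=> cg x y t t01; rewrite /h /= /P orthoprojD // !orthoprojZ //.
exact: cg.
Qed.

End GradientProjection.

(** * Proximal points *)

Section Prox.
Context {R : realType} {H : hilbertType R}.
Implicit Types (F : H -> \bar R) (x y u p : H) (gamma : R).

(** An affine minorant, provided by any subgradient, makes the proximal
    objective bounded below. *)
Lemma prox_subgrad F gamma p u x : closed_proper_convex F -> 0 < gamma ->
  subdiff F p u -> subdiff F (prox gamma F x) (gamma^-1 *: (x - prox gamma F x)).
Proof.
move=> hF g0 Fu; have [_ pF cF] := hF.
have c0 : 0 < (2 * gamma)^-1 by rewrite invr_gt0 mulr_gt0.
have [r Fp] := subdiff_fin pF Fu.
have lb y : ((r + inner u (x - p) - gamma / 2 * `|u| ^+ 2)%:E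
    <= F y + ((2 * gamma)^-1 * `|y - x| ^+ 2)%:E)%E.
  apply: le_trans (leeD2r _ (Fu y)); rewrite Fp -!EFinD lee_fin.
  have : 0 <= (2 * gamma)^-1 * `|gamma *: u + (y - x)| ^+ 2.
    by rewrite mulr_ge0 // ltW.
  rewrite (sqr_normD (gamma *: u)) sqr_normZ innerZl.
  rewrite (_ : y - p = (y - x) + (x - p)); last by vector_field.
  rewrite (innerDr u (y - x)).
  move: (inner u (y - x)) (inner u (x - p)) (`|u| ^+ 2) (`|y - x| ^+ 2).
  move=> a b c d; rewrite (_ : _^-1 * _ = gamma / 2 * c + a
     + (2 * gamma)^-1 * d); first by lra.
  by field; rewrite gt_eqF.
have := @xgetPex _ 0 _ (exists_minimizer c0 hF lb).
move=> /(minimizer_subgrad pF cF).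
rewrite -/(prox gamma F x) (_ : 2 * (2 * gamma)^-1 = gamma^-1) //.
by field; rewrite gt_eqF.
Qed.

End Prox.

(** * Rates for monotone summable sequences *)

Section Sequences.
Context {R : realType}.
Implicit Types (u a : nat -> R) (B e : R) (k n N : nat).

Lemma min_upto_le u j k : (j <= k)%N -> min_upto u k <= u j.
Proof.
move=> jk; have jk1 : (j < k.+1)%N by [].
exact: (bigmin_le_cond _ (j := Ordinal jk1)).
Qed.

Lemma min_upto_glb u k m : (forall j, (j <= k)%N -> m <= u j) ->
  m <= min_upto u k.
Proof.
move=> mu; apply: le_bigmin => [|i _]; first exact: mu.
by apply: mu; rewrite -ltnS.
Qed.

Lemma min_upto_ge0 u k : (forall j, 0 <= u j) -> 0 <= min_upto u k.
Proof. by move=> u0; exact: min_upto_glb. Qed.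

Lemma min_upto_nonincreasing u k : min_upto u k.+1 <= min_upto u k.
Proof. by apply: min_upto_glb => j jk; exact: min_upto_le (leqW jk). Qed.

(** Past an index [N] beyond which the remaining mass is at most [e / 2], the
    last [k + 1 - N >= (k + 1) / 2] terms are all at least [a k]. *)
Lemma summable_monotone_rate a B e : (forall k, 0 <= a k) ->
  (forall k, a k.+1 <= a k) -> (forall n, \sum_(i < n) a i <= B) -> 0 < e ->
  exists N, forall k, (N <= k)%N -> k.+1%:R * a k <= e.
Proof.
move=> a0 amono aB e0.
pose s := range (fun n => \sum_(i < n) a i).
have hs : has_sup s.
  by split; [exists (\sum_(i < 0) a i), 0%N|exists B => _ [n _ <-]; exact: aB].
have e2 : 0 < e / 2 by rewrite divr_gt0.
have [_ [N _ <-] sN] := sup_adherent e2 hs.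
have anti i k : (i <= k)%N -> a k <= a i.
  elim: k => [|k ih]; first by rewrite leqn0 => /eqP ->.
  by rewrite leq_eqVlt => /orP[/eqP ->//|/ih]; exact: le_trans (amono k).
exists N.*2 => k Nk.
have Nk1 : (N <= k.+1)%N by rewrite (leq_trans _ (leqW Nk)) // -addnn leq_addr.
have tail : (k.+1 - N)%:R * a k <= e / 2.
  have sk : \sum_(i < k.+1) a i <= sup s.
    by apply: ub_le_sup; [exact: hs.2|exists k.+1].
  have : (k.+1 - N)%:R * a k <= \sum_(N <= i < k.+1) a i.
    rewrite mulr_natl -sumr_const_nat; apply: ler_sum_nat => i /andP[_ ik].
    exact: anti.
  move: sk sN; rewrite -!(big_mkord xpredT a) (big_cat_nat _ Nk1) //=.
  by move: (\sum_(0 <= _ < N) _) (\sum_(N <= _ < _) _) => p q; lra.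
apply: (@le_trans _ _ (2 * ((k.+1 - N)%:R * a k))); last by lra.
rewrite mulrA ler_wpM2r // -natrM ler_nat mulnBr.
by lia.
Qed.

Lemma summable_monotone_littleo a B : (forall k, 0 <= a k) ->
  (forall k, a k.+1 <= a k) -> (forall n, \sum_(i < n) a i <= B) ->
  (a : nat -> R^o) =o_\oo (fun k => k.+1%:R^-1 : R^o).
Proof.
move=> a0 am aB; apply/eqoP => e e0.
have [N aN] := summable_monotone_rate a0 am aB e0.
exists N => // k /= Nk; rewrite !ger0_norm ?invr_ge0 //.
by rewrite ler_pdivlMr // mulrC aN.
Qed.

Lemma min_upto_littleo u B : (forall k, 0 <= u k) ->
  (forall n, \sum_(i < n) u i <= B) ->
  (min_upto u : nat -> R^o) =o_\oo (fun k => k.+1%:R^-1 : R^o).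
Proof.
move=> u0 uB; apply: (@summable_monotone_littleo _ B) => [k|k|n].
- exact: min_upto_ge0.
- exact: min_upto_nonincreasing.
- by apply: le_trans (uB n); apply: ler_sum => i _; exact: min_upto_le.
Qed.

Lemma sum_telescope_le (E b : nat -> R) n : (forall k, 0 <= E k) ->
  (forall k, b k <= E k - E k.+1) -> \sum_(i < n) b i <= E 0%N.
Proof.
move=> E0 bE; apply: (@le_trans _ _ (E 0%N - E n)); last by rewrite gerBl.
elim: n => [|n ih]; first by rewrite big_ord0 subrr.
by rewrite big_ord_recr /=; have := bE n; lra.
Qed.

Lemma mul_sqrt_le (x t c : R) : 0 <= x -> 0 <= t -> 0 <= c ->
  t * x ^+ 2 <= c ^+ 2 -> x * Num.sqrt t <= c.
Proof.
move=> x0 t0 c0 h.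
rewrite -(ler_pXn2r (_ : 0 < 2)%N) ?nnegrE ?mulr_ge0 ?sqrtr_ge0 //.
by rewrite exprMn sqr_sqrtr // mulrC.
Qed.

End Sequences.

(** * Ergodic averages *)

Section Jensen.
Context {R : realType} {H : hilbertType R}.

(** With [m] the mean, [|v| ^ 2 >= 2 <m, v> - |m| ^ 2] averages to [|m| ^ 2]. *)
Lemma sqr_norm_ergodic (lambda : nat -> R) (x : nat -> H) p k :
  (forall j, 0 < lambda j) ->
  (\sum_(i < k.+1) lambda i) * `|ergodic lambda x k - p| ^+ 2
  <= \sum_(i < k.+1) lambda i * `|x i - p| ^+ 2.
Proof.
move=> l0; set L := \sum_(i < k.+1) lambda i.
have L0 : 0 < L.
  rewrite /L big_ord_recl; apply: ltr_pwDl => //.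
  by apply: sumr_ge0 => i _; exact: ltW.
set m := ergodic lambda x k - p.
have Lm : \sum_(i < k.+1) lambda i *: (x i - p) = L *: m.
  rewrite /m /ergodic -/L scalerBr scalerA mulfV ?gt_eqF // scale1r.
  by rewrite /L scaler_suml -sumrB; apply: eq_bigr => i _; rewrite scalerBr.
have inner_sum (v : 'I_k.+1 -> H) :
    inner m (\sum_i v i) = \sum_i inner m (v i).
  apply: (big_morph (fun w : H => inner m w)) => [a b|]; first exact: innerDr.
  exact: inner0r.
have -> : L * `|m| ^+ 2
    = \sum_(i < k.+1) lambda i * (2 * inner m (x i - p) - `|m| ^+ 2).
  under eq_bigr => i _ do rewrite mulrBr mulrCA -innerZr.
  rewrite sumrB -mulr_sumr -inner_sum Lm innerZr -mulr_suml -/L -sqr_norm_inner.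
  by ring.
apply: ler_sum => i _; apply: (ler_wpM2l (ltW (l0 i))).
have := sqr_ge0 `|(x i - p) - m|; rewrite (sqr_normD (x i - p)) normrN innerNr.
by rewrite (innerC m); move: (inner _ _) => ?; lra.
Qed.

End Jensen.

(** * The fundamental inequality of the FDRS operator *)

Section FundamentalInequality.
Context {R : realType} {H : hilbertType R}.
Context {V : set H} {f g : H -> \bar R} {gamma beta_V beta_f mu_f mu_g : R}.
Hypotheses (hV : closed_subspace V) (hf : closed_proper_convex f)
  (hg : closed_proper_convex g) (dg : differentiable_fun g).
Hypotheses (gamma0 : 0 < gamma) (beta0 : 0 < beta_V).
Hypothesis hlip : (beta_V^-1).-lipschitz (gradient (g \o orthoproj V)).
Hypothesis subf : exists p u, subdiff f p u.
Hypotheses (scf : strongly_convex mu_f f) (scg : strongly_convex mu_g g).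
Hypotheses (mu_f0 : 0 <= mu_f) (mu_g0 : 0 <= mu_g).
Hypothesis df : 0 < beta_f ->
  differentiable_fun f /\ (beta_f^-1).-lipschitz (gradient f).
Implicit Types z w : H.

Let P := orthoproj V.
Let G := gradient (g \o P).
Let T := FDRS gamma f g V.
Let X z := prox gamma f (refl_proj V (forward_step gamma (g \o P) z)).

Lemma orthoproj_gradient z : P (G z) = G z.
Proof.
rewrite /G (gradient_comp_orthoproj hV dg z); exact: orthoprojK.
Qed.

Lemma gradient_orthoproj z : G (P z) = G z.
Proof.
rewrite /G (gradient_comp_orthoproj hV dg z).
rewrite (gradient_comp_orthoproj hV dg (P z)).
by congr (orthoproj V (gradient g _)); exact: orthoprojK.
Qed.

Lemma refl_forward z :
  refl_proj V (forward_step gamma (g \o P) z) = 2 *: P z - z - gamma *: G z.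
Proof.
have Py : P (z - gamma *: G z) = P z - gamma *: G z.
  have := orthoproj_gradient z; move: (G z) => Gz PGz.
  by rewrite -{2}PGz /P (orthoprojB hV) (orthoprojZ hV).
rewrite [LHS]/(2 *: P (z - gamma *: G z) - (z - gamma *: G z)) Py.
by move: (P z) (G z) => *; vector_field.
Qed.

Lemma FDRSE z : T z = z + (X z - P z).
Proof.
rewrite [LHS]/(2^-1 *: (z - gamma *: G z) + 2^-1 *: (2 *: X z
  - refl_proj V (forward_step gamma (g \o P) z))) refl_forward.
by move: (X z) (P z) (G z) => *; vector_field.
Qed.

Let U z := gamma^-1 *: (2 *: P z - z - gamma *: G z - X z).

Lemma subdiff_prox_step z : subdiff f (X z) (U z).
Proof.
have [p [u fu]] := subf.
have := prox_subgrad (refl_proj V (forward_step gamma (g \o P) z)) hf gamma0 fu.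
by rewrite -[prox _ _ _]/(X z) refl_forward.
Qed.

Lemma S_f_ge0 x y : 0 <= S_f mu_f beta_f f x y.
Proof.
have m0 : 0 <= mu_f / 2 * `|x - y| ^+ 2.
  by apply: mulr_ge0 => //; apply: divr_ge0.
by rewrite /S_f; case: ifP => // _; rewrite le_max m0.
Qed.

Lemma S_h_ge0 x y : 0 <= S_h mu_g beta_V g V x y.
Proof.
rewrite /S_h le_max; apply/orP; left.
by apply: mulr_ge0 => //; apply: divr_ge0.
Qed.

(** Strong monotonicity bounds the first entry of the maximum; when [f] is smooth
    the subgradients are gradients and cocoercivity bounds the second. *)
Lemma S_f_le x y u v : subdiff f x u -> subdiff f y v ->
  2 * S_f mu_f beta_f f x y <= inner (x - y) (u - v).
Proof.
move=> fu fv; have [_ pf cf] := hf.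
have mono := subdiff_monotone pf scf fu fv.
have h1 : 2 * (mu_f / 2 * `|x - y| ^+ 2) <= inner (x - y) (u - v).
  by move: mono; move: (inner _ _) (`|_| ^+ 2) => *; lra.
rewrite /S_f; case: ifP => // bf0; have [dff lf] := df bf0.
rewrite maxr_pMr // ge_max h1 /=.
have := cocoercive x y dff cf bf0 lf.
rewrite -(subdiff_gradient dff fu) -(subdiff_gradient dff fv).
by move: (inner _ _) (`|_| ^+ 2) => *; lra.
Qed.

Lemma cocoercive_reduced z w :
  beta_V * `|G z - G w| ^+ 2 <= inner (P z - P w) (G z - G w).
Proof.
have [_ _ cg] := hg.
have dh := differentiable_comp_orthoproj hV dg.
have := cocoercive (P z) (P w) dh (convex_comp_orthoproj hV cg) beta0 hlip.
by rewrite -/P -/G !gradient_orthoproj.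
Qed.

(** As [P z - P w] lies in [V], pairing it with [G] or with the gradient of [g]
    gives the same number, so strong convexity of [g] applies on [V]. *)
Lemma S_h_le z w : 2 * S_h mu_g beta_V g V (P z) (P w)
  <= inner (P z - P w) (G z - G w).
Proof.
have [_ pg cg] := hg.
have h2 := cocoercive_reduced z w.
have mono := gradient_monotone (P z) (P w) pg scg dg cg.
have eqG : inner (P z - P w) (G z - G w)
    = inner (P z - P w) (gradient g (P z) - gradient g (P w)).
  rewrite /G !gradient_comp_orthoproj // -(orthoprojB hV).
  by rewrite -(orthoproj_adj hV) (orthoprojB hV) !(orthoprojK hV).
rewrite -eqG in mono.
have -> : S_h mu_g beta_V g V (P z) (P w)
    = Num.max (mu_g / 2 * `|P z - P w| ^+ 2) (beta_V / 2 * `|G z - G w| ^+ 2).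
  rewrite -(gradient_orthoproj z) -(gradient_orthoproj w) /S_h.
  by congr (Num.max (_ * `|_ - _| ^+ 2) _); exact: orthoprojK.
move: mono h2 {eqG}.
move: (inner _ _) (`|P z - P w| ^+ 2) (`|_| ^+ 2) => i j k m1 m2.
rewrite maxr_pMr // ge_max.
by apply/andP; split; lra.
Qed.

(* Expressed through residuals, so that along the iteration it relates successive
   squared distances; [gapE] identifies it with the monotonicity pairings. *)
Let gap z w := - inner (T z - z - (T w - w)) (z - w)
  - `|T z - z - (T w - w)| ^+ 2
  - gamma * inner (T z - z - (T w - w)) (G z - G w).

(** The vector [P z - P w] is orthogonal to [(z - w) - (P z - P w)], which
    removes all the terms that do not contain the residual. *)
Lemma gapE z w : gap z w = gamma * inner (X z - X w) (U z - U w)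
  + gamma * inner (P z - P w) (G z - G w).
Proof.
have Pd : inner (P z - P w) (z - w - (P z - P w)) = 0.
  rewrite innerC -(orthoprojB hV) (orthoprojP hV (z - w)).2 //.
  exact: orthoproj_in.
have -> : gamma * inner (X z - X w) (U z - U w) = inner (X z - X w)
    (2 *: P z - z - gamma *: G z - X z - (2 *: P w - w - gamma *: G w - X w)).
  rewrite /U; move: (P z) (P w) (X z) (X w) (G z) (G w) => Pz Pw Xz Xw Gz Gw.
  by rewrite -innerZr scalerBr !scalerA mulfV ?gt_eqF // !scale1r.
rewrite /gap !FDRSE; move: Pd; rewrite !sqr_norm_inner.
move: (P z) (P w) (X z) (X w) (G z) (G w) => Pz Pw Xz Xw Gz Gw.
set a := Pz - Pw; set d := z - w => Pd.
pose e := (Xz - Xw) - a; pose D := Gz - Gw.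
have -> : z + (Xz - Pz) - z - (w + (Xw - Pw) - w) = e.
  by rewrite /e /a; vector_field.
have -> : Xz - Xw = a + e by rewrite /e; vector_field.
have -> : 2 *: Pz - z - gamma *: Gz - Xz - (2 *: Pw - w - gamma *: Gw - Xw)
    = a - d - gamma *: D - e.
  by rewrite /e /a /d /D; vector_field.
rewrite -/D; clearbody a d e D; move: Pd.
rewrite !innerE (innerC e a) (innerC e d) => Pd.
have -> : inner a d = inner a a by lra.
by ring.
Qed.

(** Each pairing in [gapE] is at least twice one of the optimality measures. *)
Lemma gap_S z w :
  2 * gamma * (S_f mu_f beta_f f (X z) (X w) + S_h mu_g beta_V g V (P z) (P w))
  <= gap z w.
Proof.
rewrite gapE.
have := S_f_le (subdiff_prox_step z) (subdiff_prox_step w).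
have := S_h_le z w.
move: (S_f _ _ _ _ _) (S_h _ _ _ _ _ _) => a b.
move: (inner (X z - X w) _) (inner (P z - P w) _) => c d le_d le_c.
have := ler_wpM2l (ltW gamma0) (lerD le_c le_d).
by lra.
Qed.

Lemma gap_gradient z w : gamma * beta_V * `|G z - G w| ^+ 2 <= gap z w.
Proof.
rewrite gapE.
have := S_f_le (subdiff_prox_step z) (subdiff_prox_step w).
have := S_f_ge0 (X z) (X w).
have := cocoercive_reduced z w.
move: (S_f _ _ _ _ _) (inner (X z - X w) _) (inner (P z - P w) _) (`|_| ^+ 2).
move=> a b c d le_c a0 le_b.
have := ler_wpM2l (ltW gamma0) (lerD le_c (le_trans (mulr_ge0 (ler0n _ 2) a0) le_b)).
by lra.
Qed.

(** This is [alpha]-averagedness, because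
    [1 / alpha = 2 - gamma / (2 beta_V)]: the gradient term in [gap_gradient]
    absorbs the cross term [gamma <e, D>] by completing the square. *)
Lemma residual_averaged z w :
  (2 - gamma / (2 * beta_V)) * `|T z - z - (T w - w)| ^+ 2
  <= - 2 * inner (T z - z - (T w - w)) (z - w).
Proof.
have := gap_gradient z w; rewrite /gap.
move: (T z - z - (T w - w)) (G z - G w) => e D h.
have := sqr_ge0 `|D + (2 * beta_V)^-1 *: e|.
rewrite sqr_normD sqr_normZ innerZr (innerC D).
have h2 : 0 < 2 * gamma * beta_V by rewrite !mulr_gt0.
rewrite -(ler_pM2l h2) mulr0.
move: h; move: (inner e (z - w)) (inner e D) (`|e| ^+ 2) (`|D| ^+ 2) => i j k l.
rewrite (_ : 2 * gamma * beta_V * _ = 2 * gamma * beta_V * l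
  + 2 * gamma * j + gamma / (2 * beta_V) * k).
  by lra.
by field; rewrite gt_eqF.
Qed.

Lemma gradient_lipschitz_le z w : beta_V * `|G z - G w| <= `|z - w|.
Proof.
have := lipschitz_norm z w hlip.
by rewrite -/G -(ler_pM2l beta0) mulrA mulfV ?gt_eqF // mul1r.
Qed.

End FundamentalInequality.

(** * Rates of convergence *)

Section Rates.
Context {R : realType} {H : hilbertType R}.
Implicit Types (eps : R) (j k n : nat).

(** The discriminant condition for the quadratic form of [gap_decrease].
    Multiplied by [2 beta], the bound on [lambda] leaves in
    [2 beta (2 - lambda) - gamma] at least [eps (2 beta - gamma)], and
    [K eps (2 beta - gamma)] exceeds [gamma] since [eps ^ 3 <= eps]. *)
Lemma relaxation_slack (beta gamma eps alpha lambda K : R) :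
  0 < gamma < 2 * beta -> alpha = 2 * beta / (4 * beta - gamma) ->
  0 < eps < 1 -> lambda < (1 - eps) * (1 + eps * alpha) / alpha ->
  K = (1 + eps) * gamma / (eps ^+ 3 * (2 * beta - gamma)) ->
  (1 + K) * gamma <= 2 * K * beta * (2 - lambda).
Proof.
move=> /andP[g0 gb] -> /andP[e0 e1].
have b0 : 0 < beta by lra.
have bg : 0 < 2 * beta - gamma by lra.
have c0 : 0 < 4 * beta - gamma by lra.
rewrite (_ : _ / (2 * beta / _)
    = (1 - eps) * (4 * beta - gamma + 2 * beta * eps) / (2 * beta)); last first.
  by field; rewrite !gt_eqF.
rewrite ltr_pdivlMr ?mulr_gt0 // => lam KE'.
have K0 : 0 <= K by rewrite KE' !(mulr_ge0, invr_ge0, exprn_ge0) // ltW //; lra.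
have KE : K * (eps ^+ 3 * (2 * beta - gamma)) = (1 + eps) * gamma.
  by rewrite KE' mulfVK // mulf_neq0 ?expf_neq0 // gt_eqF.
have e3 : eps ^+ 3 <= eps.
  by rewrite exprS ler_piMr ?(ltW e0) // expr_le1 // ltW.
have Ke : (1 + eps) * gamma <= K * (eps * (2 * beta - gamma)).
  by rewrite -KE ler_wpM2l // ler_wpM2r // ltW.
have Kb : 0 <= K * (2 * beta * eps ^+ 2).
  by rewrite mulr_ge0 // mulr_ge0 ?exprn_ge0 ?mulr_ge0 // ltW.
have eg : 0 <= eps * gamma by rewrite mulr_ge0 // ltW.
have Kl : K * (lambda * (2 * beta))
    <= K * ((1 - eps) * (4 * beta - gamma + 2 * beta * eps)).
  by rewrite ler_wpM2l // ltW.
by move: {KE KE'} Ke Kb eg Kl; lra.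
Qed.

Lemma quadratic_form_ge0 (a b c : R) (u v : H) : 0 < a -> b ^+ 2 <= a * c ->
  0 <= a * `|u| ^+ 2 + 2 * b * inner u v + c * `|v| ^+ 2.
Proof.
move=> a0 bac; rewrite -(pmulr_rge0 _ a0).
apply: (@le_trans _ _ (`|a *: u + b *: v| ^+ 2)); first exact: sqr_ge0.
rewrite sqr_normD !sqr_normZ innerZl innerZr.
have := ler_wpM2r (sqr_ge0 `|v|) bac; move: (inner u v) (`|u| ^+ 2) (`|v| ^+ 2).
by move=> i x y; lra.
Qed.

(** From here on [d], [e] and [D] are the differences between iterate and fixed
    point, the residuals and the gradient differences; the FDRS operator enters
    only through the inequalities of the previous part. *)

Context {gamma beta alpha : R} {lambda : nat -> R} {d e D : nat -> H}
  {S : nat -> R}.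
Hypotheses (gamma_bounds : 0 < gamma < 2 * beta)
  (alphaE : alpha = 2 * beta / (4 * beta - gamma)).
Hypothesis lambda_bounds : forall k, 0 < lambda k < alpha^-1.
Hypothesis d_step : forall k, d k.+1 = d k + lambda k *: e k.

Let gap k := - inner (e k) (d k) - `|e k| ^+ 2 - gamma * inner (e k) (D k).

Hypotheses (S_ge0 : forall k, 0 <= S k)
  (gap_S : forall k, 2 * gamma * S k <= gap k)
  (gap_D : forall k, gamma * beta * `|D k| ^+ 2 <= gap k)
  (lip_D : forall k, beta * `|D k| <= `|d k|)
  (averaged : forall k, (2 - gamma / (2 * beta)) * `|e k| ^+ 2
     <= - 2 * inner (e k) (d k))
  (averaged_step : forall k, (2 - gamma / (2 * beta)) * `|e k.+1 - e k| ^+ 2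
     <= - 2 * inner (e k.+1 - e k) (d k.+1 - d k)).

Let gamma0 : 0 < gamma. Proof. by case/andP: gamma_bounds. Qed.
Let beta0 : 0 < beta. Proof. by case/andP: gamma_bounds => *; lra. Qed.

Let lambda0 k : 0 < lambda k. Proof. by case/andP: (lambda_bounds k). Qed.

Let alphaVE : alpha^-1 = 2 - gamma / (2 * beta).
Proof.
by case/andP: gamma_bounds => *; rewrite alphaE; field; rewrite !gt_eqF //; lra.
Qed.

Let alpha0 : 0 < alpha.
Proof. by rewrite -invr_gt0 (lt_trans _ (andP (lambda_bounds 0)).2) ?lambda0. Qed.

Lemma sqr_norm_step k : `|d k.+1| ^+ 2
  = `|d k| ^+ 2 + 2 * lambda k * inner (e k) (d k) + lambda k ^+ 2 * `|e k| ^+ 2.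
Proof. by rewrite d_step sqr_normD sqr_normZ innerZr innerC; ring. Qed.

(** One plus the multiple of the decrease of [|d k| ^ 2] that dominates the
    quadratic form in [gap_decrease]. *)
Definition energy_const eps : R :=
  1 + (1 + eps) * gamma / (eps ^+ 3 * (2 * beta - gamma)).

Lemma energy_const_gt1 eps : 0 < eps < 1 -> 1 < energy_const eps.
Proof.
move=> /andP[e0 e1]; case/andP: gamma_bounds => g0 gb.
by rewrite ltrDl divr_gt0 // mulr_gt0 ?exprn_gt0 //; lra.
Qed.

(** The optimality gap is the decrease of the squared distance plus a quadratic
    form in the residual [e k] and the gradient difference [D k].  Cocoercivity
    ([gap_D]) lets a multiple of the decrease dominate that form. *)
Lemma gap_decrease eps k : 0 < eps < 1 ->
  lambda k < (1 - eps) * (1 + eps * alpha) / alpha ->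
  2 * lambda k * gap k
  <= energy_const eps * `|d k| ^+ 2 - energy_const eps * `|d k.+1| ^+ 2.
Proof.
move=> eps01 lam; have := energy_const_gt1 eps01.
rewrite /energy_const; set K := (1 + eps) * _ / _ => K1.
have slack := relaxation_slack gamma_bounds alphaE eps01 lam (erefl K).
have K0 : 0 < K by lra.
have l2 : 0 < (1 + K) * (2 - lambda k).
  apply: mulr_gt0; first by lra.
  have : 0 < 2 * K * beta * (2 - lambda k).
    by apply: lt_le_trans slack; rewrite mulr_gt0 //; lra.
  by rewrite pmulr_rgt0 // mulr_gt0 // mulr_gt0.
have disc : ((1 + K) * gamma) ^+ 2
    <= (1 + K) * (2 - lambda k) * (2 * K * gamma * beta).
  rewrite expr2.
  have -> : (1 + K) * (2 - lambda k) * (2 * K * gamma * beta)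
    = (1 + K) * gamma * (2 * K * beta * (2 - lambda k)) by ring.
  by rewrite ler_wpM2l // mulr_ge0 ?ltW //; lra.
have := mulr_ge0 (ltW (lambda0 k)) (quadratic_form_ge0 (e k) (D k) l2 disc).
have := ler_wpM2l (mulr_ge0 (ltW K0) (ltW (lambda0 k))) (gap_D k).
rewrite sqr_norm_step /gap; clear slack disc l2 K1; clearbody K.
move: (inner (e k) (d k)) (inner (e k) (D k)) (`|e k| ^+ 2) (`|D k| ^+ 2).
by move: (`|d k| ^+ 2) (lambda k) => N l i w x y; lra.
Qed.

Lemma weighted_sum_S eps n : 0 < eps < 1 ->
  (forall k, lambda k < (1 - eps) * (1 + eps * alpha) / alpha) ->
  4 * gamma * \sum_(k < n) lambda k * S k <= energy_const eps * `|d 0%N| ^+ 2.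
Proof.
move=> eps01 lam; have C1 := energy_const_gt1 eps01.
rewrite mulr_sumr.
apply: (sum_telescope_le (E := fun k => energy_const eps * `|d k| ^+ 2)
  (b := fun k => 4 * gamma * (lambda k * S k))) => k.
  by rewrite mulr_ge0 // ltW //; lra.
apply: le_trans (gap_decrease eps01 (lam k)).
have := ler_wpM2l (ltW (lambda0 k)) (gap_S k).
by move: (gap k) => *; lra.
Qed.

Lemma sqr_norm_decrease k :
  (1 - alpha * lambda k) * lambda k / alpha * `|e k| ^+ 2
  <= `|d k| ^+ 2 - `|d k.+1| ^+ 2.
Proof.
rewrite sqr_norm_step.
have -> : (1 - alpha * lambda k) * lambda k / alpha
    = lambda k * (alpha^-1 - lambda k) by field; rewrite gt_eqF.
have := ler_wpM2l (ltW (lambda0 k)) (averaged k); rewrite -alphaVE.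
by move: (inner _ _) (`|e k| ^+ 2) => *; lra.
Qed.

Let tau_gt0 k : 0 < (1 - alpha * lambda k) * lambda k / alpha.
Proof.
rewrite divr_gt0 // mulr_gt0 // subr_gt0 -ltr_pdivlMl // mulr1.
by case/andP: (lambda_bounds k).
Qed.

Lemma distance_le k : `|d k| <= `|d 0%N|.
Proof.
elim: k => // k; apply: le_trans; rewrite -(ler_pXn2r (_ : 0 < 2)%N) //
  ?nnegrE // -subr_ge0; apply: le_trans (sqr_norm_decrease k).
by rewrite mulr_ge0 // ltW.
Qed.

(** Averagedness between consecutive iterates, whose difference is
    [lambda k *: e k] with [lambda k < 1 / alpha]. *)
Lemma residual_nonincreasing k : `|e k.+1| ^+ 2 <= `|e k| ^+ 2.
Proof.
have dk : d k.+1 - d k = lambda k *: e k by rewrite d_step addrC addKr.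
have ek : `|e k.+1| ^+ 2 = `|e k| ^+ 2 + 2 * inner (e k.+1 - e k) (e k)
    + `|e k.+1 - e k| ^+ 2.
  by rewrite innerC -sqr_normD [e k + _]addrC subrK.
have := averaged_step k; rewrite ek dk innerZr -alphaVE.
move: (e k.+1 - e k) => E.
have /andP[l0 la] := lambda_bounds k.
have := ler_wpM2r (sqr_ge0 `|E|) (ltW la).
move: (inner _ _) (`|E| ^+ 2) (`|e k| ^+ 2) => i x y h1 h2.
have : lambda k * (2 * i + x) <= 0 by lra.
by rewrite pmulr_rle0 //; lra.
Qed.

Lemma residual_sum tau n : 0 <= tau ->
  (forall k, tau <= (1 - alpha * lambda k) * lambda k / alpha) ->
  \sum_(k < n) tau * `|e k| ^+ 2 <= `|d 0%N| ^+ 2.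
Proof.
move=> tau0 tauP.
apply: (sum_telescope_le (E := fun k => `|d k| ^+ 2)
  (b := fun k => tau * `|e k| ^+ 2)) => // k.
by apply: le_trans (sqr_norm_decrease k); rewrite ler_wpM2r.
Qed.

Lemma residual_rate tau k : 0 <= tau ->
  (forall k, tau <= (1 - alpha * lambda k) * lambda k / alpha) ->
  tau * k.+1%:R * `|e k| ^+ 2 <= `|d 0%N| ^+ 2.
Proof.
move=> tau0 tauP; apply: le_trans (residual_sum k.+1 tau0 tauP).
have anti i : (i <= k)%N -> `|e k| ^+ 2 <= `|e i| ^+ 2.
  elim: k => [|k ih]; first by rewrite leqn0 => /eqP ->.
  rewrite leq_eqVlt => /orP[/eqP -> //|/ih].
  exact: le_trans (residual_nonincreasing k).
rewrite mulrAC mulr_natr -[in leLHS](card_ord k.+1) -sumr_const.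
apply: ler_sum => i _; rewrite ler_wpM2l // anti //.
by rewrite -ltnS.
Qed.

Lemma S_le_residual k :
  2 * gamma * S k <= (1 + gamma / beta) * `|e k| * `|d 0%N|.
Proof.
apply: le_trans (gap_S k) _; rewrite /gap.
have c1 : - inner (e k) (d k) <= `|e k| * `|d k|.
  by rewrite -innerNl -(normrN (e k)) cauchy_schwarz.
have c2 : - inner (e k) (D k) <= `|e k| * `|D k|.
  by rewrite -innerNl -(normrN (e k)) cauchy_schwarz.
have D0 : `|D k| <= beta^-1 * `|d 0%N|.
  by rewrite ler_pdivlMl //; apply: le_trans (lip_D k) (distance_le k).
have h1 := ler_wpM2l (normr_ge0 (e k)) (distance_le k).
have h2 := ler_wpM2l (ltW gamma0)
  (le_trans c2 (ler_wpM2l (normr_ge0 (e k)) D0)).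
have := sqr_ge0 `|e k|; move: h1 h2 c1 {c2 D0}.
move: (inner _ _) (inner _ _) (`|e k|) (`|d k|) (`|d 0%N|) (beta^-1).
by move=> i j a b c q *; lra.
Qed.

Lemma S_rate tau k : 0 < tau ->
  (forall k, tau <= (1 - alpha * lambda k) * lambda k / alpha) ->
  S k <= (1 + gamma / beta) * `|d 0%N| ^+ 2
    / (2 * gamma * Num.sqrt (tau * k.+1%:R)).
Proof.
move=> tau0 tauP; have t0 : 0 < tau * k.+1%:R by rewrite mulr_gt0.
have s0 : 0 < Num.sqrt (tau * k.+1%:R) by rewrite sqrtr_gt0.
rewrite ler_pdivlMr ?mulr_gt0 //.
have ek : `|e k| * Num.sqrt (tau * k.+1%:R) <= `|d 0%N|.
  by apply: mul_sqrt_le; rewrite ?(ltW t0) //; exact: residual_rate (ltW tau0) _.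
have gb : 0 <= 1 + gamma / beta by rewrite addr_ge0 // divr_ge0 // ltW.
have := ler_wpM2r (ltW s0) (S_le_residual k).
have := ler_wpM2l gb (ler_wpM2r (normr_ge0 (d 0%N)) ek).
move: (Num.sqrt _) (`|e k|) (`|d 0%N|) (S k) (1 + _) => s a c b q.
by lra.
Qed.

Lemma S_littleo tau : 0 < tau ->
  (forall k, tau <= (1 - alpha * lambda k) * lambda k / alpha) ->
  (S : nat -> R^o) =o_\oo (fun k => (Num.sqrt k.+1%:R)^-1 : R^o).
Proof.
move=> tau0 tauP; apply/eqoP => eps eps0.
pose q := (1 + gamma / beta) * `|d 0%N| / (2 * gamma).
have q0 : 0 <= q.
  by rewrite /q !(mulr_ge0, addr_ge0, invr_ge0, divr_ge0) // ltW.
have Sq k : S k <= q * `|e k|.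
  rewrite /q mulrAC ler_pdivlMr ?mulr_gt0 //.
  by have := S_le_residual k; move: (`|d 0%N|) (`|e k|) (S k) (1 + _) => *; lra.
have q1 : 0 < q + 1 by rewrite ltr_wpDl.
have sumB n : \sum_(k < n) `|e k| ^+ 2 <= tau^-1 * `|d 0%N| ^+ 2.
  by rewrite ler_pdivlMl // mulr_sumr residual_sum // ltW.
have r0 : 0 < (eps / (q + 1)) ^+ 2 by rewrite exprn_gt0 // divr_gt0.
have [N eN] := summable_monotone_rate (fun k => sqr_ge0 `|e k|)
  residual_nonincreasing sumB r0.
exists N => // k /= Nk.
have sk : 0 < Num.sqrt k.+1%:R :> R by rewrite sqrtr_gt0.
rewrite ger0_norm // gtr0_norm ?invr_gt0 // ler_pdivlMr //.
have e1 : `|e k| * Num.sqrt k.+1%:R <= eps / (q + 1).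
  by apply: mul_sqrt_le => //; [rewrite divr_ge0 // ltW|exact: eN].
apply: (@le_trans _ _ (q * (`|e k| * Num.sqrt k.+1%:R))).
  by rewrite mulrA ler_wpM2r // ltW.
apply: le_trans (ler_wpM2l q0 e1) _.
by rewrite mulrA ler_pdivrMr // mulrC ler_pM2l // lerDl.
Qed.

End Rates.

(** * Convergence of the FDRS iteration *)

Theorem theorem4p1 (R : realType) (H : hilbertType R)
  (V : set H) (f g : H -> \bar R) (beta beta_V beta_f mu_f mu_g : R)
  (hV : closed_subspace V)
  (hf : closed_proper_convex f) (hg : closed_proper_convex g)
  (hbeta : 0 < beta) (hgdiff : differentiable_fun g)
  (hglip : (beta^-1).-lipschitz (gradient g))
  (hbeta_V : 0 < beta_V)
  (hhlip : (beta_V^-1).-lipschitz (gradient (g \o orthoproj V)))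
  (hsol : exists x : H,
     [set u + gradient g x + w | u in subdiff f x & w in subdiff (indicator V) x] 0)
  (hmu_f : 0 <= mu_f) (hmu_g : 0 <= mu_g)
  (hfsc : strongly_convex mu_f f) (hgsc : strongly_convex mu_g g)
  (hbeta_f : 0 <= beta_f)
  (hfdiff : 0 < beta_f ->
     differentiable_fun f /\ (beta_f^-1).-lipschitz (gradient f))
  (gamma : R) (hgamma : 0 < gamma < 2 * beta_V)
  (alpha : R) (halpha : alpha = 2 * beta_V / (4 * beta_V - gamma))
  (lambda : nat -> R) (hlambda : forall j, 0 < lambda j < alpha^-1)
  (z : nat -> H)
  (hz : forall k, z k.+1 = relax (lambda k) (FDRS gamma f g V) (z k))
  (zs : H) (hzs : FDRS gamma f g V zs = zs)
  (xs : H) (hxs : xs = orthoproj V zs) :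
  let xf := x_f gamma f g V z in
  let xh := x_h V z in
  let Sf := fun k => S_f mu_f beta_f f (xf k) xs in
  let Sh := fun k => S_h mu_g beta_V g V (xh k) xs in
  let C := fun eps : R =>
    1 + (1 + eps) * gamma / (eps ^+ 3 * (2 * beta_V - gamma)) in
  [/\ (* best iterate *)
      forall eps : R, 0 < eps < 1 ->
      (forall j, 0 < lambda j < (1 - eps) * (1 + eps * alpha) / alpha) ->
      let lambda_inf := inf (range lambda) in
      0 < lambda_inf ->
      [/\ forall k : nat, min_upto (fun j => Sf j + Sh j) k
            <= C eps * `|z 0%N - zs| ^+ 2
               / (4 * gamma * lambda_inf * k.+1%:R),
          (min_upto Sf : nat -> R^o) =o_\oo (fun k : nat => k.+1%:R^-1 : R^o)
        & (min_upto Sh : nat -> R^o) =o_\oo (fun k : nat => k.+1%:R^-1 : R^o)],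
      (* ergodic *)
      forall eps : R, 0 < eps < 1 ->
      (forall j, 0 < lambda j < (1 - eps) * (1 + eps * alpha) / alpha) ->
      forall k : nat,
        mu_f / 2 * `|ergodic lambda xf k - xs| ^+ 2
        + mu_g / 2 * `|ergodic lambda xh k - xs| ^+ 2
        <= C eps * `|z 0%N - zs| ^+ 2
           / (4 * gamma * \sum_(i < k.+1) lambda i)
    & (* nonergodic *)
      let tau_inf :=
        inf (range (fun j => (1 - alpha * lambda j) * lambda j / alpha)) in
      0 < tau_inf ->
      ((fun k => Sf k + Sh k) : nat -> R^o)
        =o_\oo (fun k : nat => (Num.sqrt k.+1%:R)^-1 : R^o)
      /\ forall k : nat, Sf k + Sh k
         <= (1 + gamma / beta_V) * `|z 0%N - zs| ^+ 2
            / (2 * gamma * Num.sqrt (tau_inf * k.+1%:R))].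
Proof.
move=> xf xh Sf Sh C; case/andP: (hgamma) => g0 g2b.
have subf : exists p u, subdiff f p u.
  by have [x [u fu _]] := hsol; exists x, u.
(* The operators are replaced by variables: only their inequalities matter from
   here on. *)
have [T TE] : exists T, FDRS gamma f g V = T by exists (FDRS gamma f g V).
have [G GE] : exists G, gradient (g \o orthoproj V) = G.
  by exists (gradient (g \o orthoproj V)).
have Tzs : T zs - zs = 0 by rewrite -TE hzs subrr.
pose d k := z k - zs; pose e k := T (z k) - z k; pose D k := G (z k) - G zs.
pose S k := Sf k + Sh k.
have eE k : T (z k) - z k - (T zs - zs) = e k by rewrite Tzs subr0.
(* A fixed point has zero residual, so its proximal point is its projection. *)
have xfs :
    prox gamma f (refl_proj V (forward_step gamma (g \o orthoproj V) zs)) = xs.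
  have := FDRSE (f := f) (gamma := gamma) hV hgdiff zs.
  rewrite hzs -hxs => /eqP; rewrite addrC -subr_eq subrr eq_sym subr_eq0.
  by move/eqP.
have d_step k : d k.+1 = d k + lambda k *: e k.
  by rewrite /d /e hz /relax TE; vector_field.
have Sf0 k : 0 <= Sf k by exact: S_f_ge0.
have Sh0 k : 0 <= Sh k by exact: S_h_ge0.
have S0 k : 0 <= S k by rewrite addr_ge0.
have gap_S k : 2 * gamma * S k
    <= - inner (e k) (d k) - `|e k| ^+ 2 - gamma * inner (e k) (D k).
  rewrite /S /Sf /Sh -{1}xfs hxs.
  have := gap_S hV hf hg hgdiff g0 hbeta_V hhlip subf hfsc hgsc hfdiff (z k) zs.
  by rewrite TE GE eE.
have gap_D k : gamma * beta_V * `|D k| ^+ 2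
    <= - inner (e k) (d k) - `|e k| ^+ 2 - gamma * inner (e k) (D k).
  have := gap_gradient hV hf hg hgdiff g0 hbeta_V hhlip subf hfsc hmu_f hfdiff
    (z k) zs.
  by rewrite TE GE eE.
have lip_D k : beta_V * `|D k| <= `|d k|.
  by have := gradient_lipschitz_le hbeta_V hhlip (z k) zs; rewrite GE.
have averaged := residual_averaged hV hf hg hgdiff g0 hbeta_V hhlip subf hfsc
  hmu_f hfdiff.
rewrite TE in averaged.
have averaged0 k : (2 - gamma / (2 * beta_V)) * `|e k| ^+ 2
    <= - 2 * inner (e k) (d k).
  by have := averaged (z k) zs; rewrite eE.
have averaged_step k : (2 - gamma / (2 * beta_V)) * `|e k.+1 - e k| ^+ 2
    <= - 2 * inner (e k.+1 - e k) (d k.+1 - d k).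
  have -> : d k.+1 - d k = z k.+1 - z k by rewrite /d; vector_field.
  exact: averaged.
have l0 k : 0 < lambda k by case/andP: (hlambda k).
split.
- move=> eps eps01 lam linf linf0.
  have lam' k : lambda k < (1 - eps) * (1 + eps * alpha) / alpha.
    by case/andP: (lam k).
  have wsum n := weighted_sum_S hgamma halpha hlambda d_step gap_S gap_D n
    eps01 lam'.
  have linf_le k : linf <= lambda k.
    by apply: ge_inf; [exists 0 => _ [j _ <-]; exact: ltW|exists k].
  have sumB n : 4 * gamma * linf * \sum_(k < n) S k
      <= C eps * `|z 0%N - zs| ^+ 2.
    apply: le_trans (wsum n); rewrite -[leLHS]mulrA ler_pM2l ?mulr_gt0 //.
    by rewrite mulr_sumr; apply: ler_sum => k _; exact: ler_wpM2r.
  have c0 : 0 < 4 * gamma * linf by rewrite !mulr_gt0.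
  pose B := C eps * `|z 0%N - zs| ^+ 2 / (4 * gamma * linf).
  have sumS n : \sum_(k < n) S k <= B by rewrite ler_pdivlMr // mulrC sumB.
  split=> [k||].
  + rewrite ler_pdivlMr ?mulr_gt0 //; apply: le_trans (sumB k.+1).
    rewrite mulrC -[leLHS]mulrA ler_pM2l // mulr_natl.
    rewrite -[in leLHS](card_ord k.+1) -sumr_const; apply: ler_sum => i _.
    by apply: min_upto_le; rewrite -ltnS.
  + apply: (@min_upto_littleo _ Sf B) => // n; apply: le_trans (sumS n).
    by apply: ler_sum => i _; rewrite lerDl.
  + apply: (@min_upto_littleo _ Sh B) => // n; apply: le_trans (sumS n).
    by apply: ler_sum => i _; rewrite lerDr.
- move=> eps eps01 lam k.
  have lam' j : lambda j < (1 - eps) * (1 + eps * alpha) / alpha.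
    by case/andP: (lam j).
  have wsum := weighted_sum_S hgamma halpha hlambda d_step gap_S gap_D k.+1
    eps01 lam'.
  have L0 : 0 < \sum_(i < k.+1) lambda i.
    by rewrite big_ord_recl ltr_pwDl // sumr_ge0 // => i _; exact: ltW.
  rewrite ler_pdivlMr ?mulr_gt0 //; apply: le_trans wsum.
  rewrite [leLHS]mulrC -[leLHS]mulrA ler_pM2l ?mulr_gt0 //.
  have jf := sqr_norm_ergodic xf xs k l0.
  have jh := sqr_norm_ergodic xh xs k l0.
  have Sf_ge j : mu_f / 2 * `|xf j - xs| ^+ 2 <= Sf j.
    by rewrite /Sf /S_f; case: ifP => // _; rewrite le_max lexx.
  have Sh_ge j : mu_g / 2 * `|xh j - xs| ^+ 2 <= Sh j.
    rewrite /Sh /S_h le_max; apply/orP; left.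
    by rewrite /xh /x_h hxs !(orthoprojK hV).
  have mf : 0 <= mu_f / 2 by rewrite divr_ge0.
  have mg : 0 <= mu_g / 2 by rewrite divr_ge0.
  have {jf} := ler_wpM2l mf jf; have {jh} := ler_wpM2l mg jh.
  rewrite !mulr_sumr => jh jf.
  apply: (@le_trans _ _ (\sum_(i < k.+1) lambda i * (mu_f / 2 * `|xf i - xs| ^+ 2
    + mu_g / 2 * `|xh i - xs| ^+ 2))); last first.
    by apply: ler_sum => i _; rewrite ler_pM2l // lerD.
  rewrite mulrDr; under [leRHS]eq_bigr do rewrite mulrDr; rewrite big_split /=.
  by apply: lerD; rewrite mulrCA; [apply: le_trans jf _|apply: le_trans jh _];
    apply: ler_sum => i _; rewrite mulrCA.
- move=> tau tau0.
  have tau_le k : tau <= (1 - alpha * lambda k) * lambda k / alpha.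
    apply: ge_inf; last by exists k.
    exists 0 => _ [j _ <-]; case/andP: (hlambda j) => lj lja.
    have a0 : 0 < alpha by rewrite -invr_gt0 (lt_trans lj).
    rewrite divr_ge0 ?(ltW a0) // mulr_ge0 ?(ltW lj) // subr_ge0.
    by rewrite -ler_pdivlMl // mulr1 ltW.
  split.
    exact: (S_littleo hgamma halpha hlambda d_step S0 gap_S lip_D
      averaged0 averaged_step tau0 tau_le).
  move=> k.
  exact: (S_rate hgamma halpha hlambda d_step gap_S lip_D
    averaged0 averaged_step k tau0 tau_le).
Qed.
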